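(* Let $\kappa=[2\ell-1]$ for some $\ell\in\mathbb Z$, let $t=F+\check E+\kappa K^{-1}\in\mathbf U$, and define for $a\ge0$ $$\dot t^{(2a)}=\frac{t}{[2a]!}\prod_{j=-a+1}^{a-1}\bigl(t-[2j]\bigr),\qquad \dot t^{(2a+1)}=\frac{1}{[2a+1]!}\prod_{j=-a}^{a}\bigl(t-[2j]\bigr).$$ Then for every $m\ge1$, in $\mathbf U$, $$\dot t^{(2m)}=\sum_{b=0}^{2m}\sum_{a=0}^{b}\sum_{c\ge0} q^{\binom{2c}{2}-2c-b(2m-b-2c)-a(b-a)}\,\mathfrak p^{(2m-b-2c)}(\kappa)\;\check E^{(a)}\Bigl\{\begin{matrix}h;2-m\\ c\end{matrix}\Bigr\}K^{b-2m+2c}F^{(b-a)},$$ $$\dot t^{(2m-1)}=\sum_{b=0}^{2m-1}\sum_{a=0}^{b}\sum_{c\ge0} q^{\binom{2c}{2}-b(2m-b-2c-1)-a(b-a)}\,\mathfrak p^{(2m-b-2c-1)}(\kappa)\;\check E^{(a)}\Bigl\{\begin{matrix}h;2-m\\ c\end{matrix}\Bigr\}K^{b-2m+2c+1}F^{(b-a)}.$$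
   Context: $q$ is an indeterminate, $[n]=\frac{q^n-q^{-n}}{q-q^{-1}}$ for $n\in\mathbb Z$, $[n]!=[1]\cdots[n]$, $[0]!=1$. $\mathbf U$ is the $\mathbb Q(q)$-algebra generated by $E,F,K^{\pm1}$ with relations $KK^{-1}=K^{-1}K=1$, $EF-FE=\frac{K-K^{-1}}{q-q^{-1}}$, $KE=q^2EK$, $KF=q^{-2}FK$. Put $\check E=q^{-1}EK^{-1}$, $\check E^{(n)}=\check E^n/[n]!$, $F^{(n)}=F^n/[n]!$. For $a\in\mathbb Z$, $n\in\mathbb N$: $\Bigl\{\begin{matrix}h;a\\ n\end{matrix}\Bigr\}=\prod_{i=1}^{n}\frac{q^{4a+4i-4}K^{-2}-q^2}{q^{4i}-1}$ (equal to $1$ for $n=0$). The polynomials $\mathfrak p_n(x)$ are defined by $\mathfrak p_0=1$, $\mathfrak p_n=0$ for $n<0$, $\mathfrak p_{n+1}=x\,\mathfrak p_n+q^{2-2n}[n][n-2]\,\mathfrak p_{n-1}$ ($n\ge0$); $\mathfrak p^{(n)}=\mathfrak p_n/[n]!$ for $n\ge0$ and $\mathfrak p^{(n)}=0$ for $n<0$. *)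

(* Defs.v *)
From HB Require Import structures.
From mathcomp Require Import all_boot all_order all_algebra.
Set Implicit Arguments. Unset Strict Implicit. Unset Printing Implicit Defensive.
Import Order.TTheory GRing.Theory Num.Theory.
Local Open Scope ring_scope.

Definition Qq : fieldType := {fraction {poly rat}}.
Definition qq : Qq := FracField.tofrac ('X : {poly rat}).

Definition qint (n : int) : Qq := (qq ^ n - qq ^ (- n)) / (qq - qq^-1).
Definition qfact (n : nat) : Qq := \prod_(1 <= i < n.+1) qint i%:Z.

Fixpoint pp (n : nat) : {poly Qq} :=
  match n with
  | 0 => 1
  | n'.+1 =>
      match n' with
      | 0 => 'X
      | n''.+1 => 'X * pp n'
                  + (qq ^ (2 - 2 * n'%:Z) * qint n'%:Z * qint (n'%:Z - 2)) *: pp n''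
      end
  end.

Definition pcoef_div (n : int) (x : Qq) : Qq :=
  match n with
  | Posz k => (pp k).[x] / qfact k
  | Negz _ => 0
  end.

Section UqElements.
Variable A : algType Qq.
Variables E F K Kinv : A.

Definition Uq_relations : Prop :=
  [/\ K * Kinv = 1, Kinv * K = 1,
      E * F - F * E = (qq - qq^-1)^-1 *: (K - Kinv),
      K * E = qq ^+ 2 *: (E * K) &
      K * F = qq ^- 2 *: (F * K)].

Definition Kz (z : int) : A :=
  match z with
  | Posz n => K ^+ n
  | Negz n => Kinv ^+ n.+1
  end.

Definition Echk : A := qq^-1 *: (E * Kinv).
Definition Echkdiv (n : nat) : A := (qfact n)^-1 *: Echk ^+ n.
Definition Fdiv (n : nat) : A := (qfact n)^-1 *: F ^+ n.

Definition hbrace (a : int) (n : nat) : A :=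
  \prod_(1 <= i < n.+1)
     ((qq ^+ (4 * i) - 1)^-1 *: (qq ^ (4 * a + 4 * i%:Z - 4) *: Kinv ^+ 2 - (qq ^+ 2)%:A)).

Definition tU (kappa : Qq) : A := F + Echk + kappa *: Kinv.

Definition tdot_even (kappa : Qq) (a : nat) : A :=
  (qfact (2 * a))^-1 *:
    (tU kappa * \prod_(0 <= i < (2 * a).-1)
                   (tU kappa - (qint (2 * (i%:Z - a%:Z + 1)))%:A)).

Definition tdot_odd (kappa : Qq) (a : nat) : A :=
  (qfact (2 * a).+1)^-1 *:
    \prod_(0 <= i < (2 * a).+1) (tU kappa - (qint (2 * (i%:Z - a%:Z)))%:A).

End UqElements.

(* Main.v *)
(* Since the products defining the divided powers telescope, with
   o_m := tdot^(2m-1) and e_m := tdot^(2m) one has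
     t o_m = [2m] e_m   and   t e_m = [2m+1] o_(m+1) + [2m] o_m,
   which together with e_0 = 1 determine both sequences; so it suffices that the
   right-hand sides satisfy the same recursion.  Put k := K^-1.  As p^(n) = 0 for
   n < 0, the coefficient of check-E^(a) _ F^(d) in a right-hand side is
   q^(-a d) G_b(k), with b = a + d and G_b a polynomial in k.  Multiplying by t on
   the left produces, in front of check-E^(a) _ F^(d), an expression affine in
   q^(-2a) once b is fixed.  The linear part vanishes because of the three-term
   recursion for the p^(n) (gpoly_balance); the constant part, by the q-Pascal
   relations between {h;a,c}, {h;a-1,c} and {h;a,c-1}, is the coefficient
   predicted by the recursion (gpoly_raise_odd, gpoly_raise_even). *)
Require Import Defs.
From HB Require Import structures.
From mathcomp Require Import all_boot all_order all_algebra.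
From mathcomp Require Import ring zify.
Import Order.TTheory GRing.Theory Num.Theory.
Local Open Scope ring_scope.

(** * Quantum integers *)

Lemma qq_neq0 : qq != 0.
Proof. by rewrite /qq tofrac_eq0 polyX_eq0. Qed.

Lemma qq_expn_neq1 n : (0 < n)%N -> qq ^+ n - 1 != 0.
Proof.
move=> n_gt0; rewrite /qq -rmorphXn -(rmorph1 (@FracField.tofrac _)) -rmorphB.
by rewrite /= tofrac_eq0 -size_poly_eq0 size_XnsubC.
Qed.

(* Unfolding the fraction field makes unification and [field] diverge; below,
   scalar identities are proved after generalizing [Qq] to an arbitrary field. *)
Local Opaque Qq qq.

Lemma expfn_subV_neq0 (R : fieldType) (x : R) n :
  x != 0 -> x ^+ (n + n) - 1 != 0 -> x ^+ n - x ^- n != 0.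
Proof.
move=> x_neq0; apply: contraNneq => /eqP; rewrite subr_eq0 => /eqP e.
by rewrite exprD {1}e mulVf ?subrr ?expf_neq0.
Qed.

Lemma qq_subV_neq0 : qq - qq^-1 != 0.
Proof. exact: (@expfn_subV_neq0 Qq qq 1 qq_neq0 (@qq_expn_neq1 2 isT)). Qed.

Lemma qint_nat_neq0 n : (0 < n)%N -> qint n%:Z != 0.
Proof.
move=> n_gt0; rewrite /qint.
apply: mulf_neq0; last by rewrite invr_eq0 qq_subV_neq0.
rewrite -exprnN -exprnP.
apply: expfn_subV_neq0; first exact: qq_neq0.
by apply: qq_expn_neq1; rewrite addn_gt0 n_gt0.
Qed.

Lemma qintE n : qint n = (qq ^ n - qq ^ (- n)) / (qq - qq^-1).
Proof. by []. Qed.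

Local Opaque qint.

Lemma qint0 : qint 0 = 0.
Proof. by rewrite qintE oppr0 subrr mul0r. Qed.

Lemma qintN n : qint (- n) = - qint n.
Proof. by rewrite !qintE opprK -mulNr opprB. Qed.

Lemma qfact0 : qfact 0 = 1.
Proof. by rewrite /qfact big_geq. Qed.

Lemma qfactS n : qfact n.+1 = qint n.+1%:Z * qfact n.
Proof. by rewrite /qfact big_nat_recr //= mulrC. Qed.

Lemma qfact_neq0 n : qfact n != 0.
Proof.
elim: n => [|n IH]; first by rewrite qfact0 oner_neq0.
by rewrite qfactS mulf_neq0 ?qint_nat_neq0.
Qed.

Lemma qqD (i j : int) : qq ^ (i + j) = qq ^ i * qq ^ j.
Proof. exact: expfzDr qq_neq0. Qed.

(* The cases j <= 1 rely on the convention p^(n) = 0 for n < 0. *)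
Lemma pcoef_div_rec (x : Qq) (j : int) :
  qint j * pcoef_div j x = x * pcoef_div (j - 1) x
    + qq ^ (4 - 2 * j) * qint (j - 3) * pcoef_div (j - 2) x.
Proof.
case: j => [[|[|n]]|n].
- by rewrite qint0 /= !mulr0 mul0r addr0.
- have -> : 1%:Z - 1 = 0 by [].
  have -> : pcoef_div (1 - 2) x = 0 by [].
  rewrite mulr0 addr0 /pcoef_div /= qfactS qfact0 hornerX (hornerC 1 x) mulr1 divr1.
  by rewrite mulrC divfK ?mulr1 // qint_nat_neq0.
- have -> : n.+2%:Z - 1 = n.+1%:Z by lia.
  have -> : n.+2%:Z - 2 = n%:Z by lia.
  have -> : n.+2%:Z - 3 = n.+1%:Z - 2 by lia.
  have -> : 4 - 2 * n.+2%:Z = 2 - 2 * n.+1%:Z by lia.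
  rewrite [pcoef_div n.+2 x]/pcoef_div -[pp n.+2]/('X * pp n.+1
     + (qq ^ (2 - 2 * n.+1%:Z) * qint n.+1%:Z * qint (n.+1%:Z - 2)) *: pp n).
  rewrite hornerD hornerZ hornerM hornerX /pcoef_div !qfactS.
  have := qfact_neq0 n; have := qint_nat_neq0 n.+1 isT; have := qint_nat_neq0 n.+2 isT.
  move: x (pp n.+1).[x] (pp n).[x] (qint n.+2) (qint n.+1) (qfact n).
  move: (qint (n.+1%:Z - 2)) (qq ^ _); move: Qq => R *; field.
  by repeat (apply/andP; split).
- have -> : Negz n - 1 = Negz n.+1 by lia.
  have -> : Negz n - 2 = Negz n.+2 by lia.
  by rewrite /= !mulr0 addr0.
Qed.

Lemma pcoef_div_neg (j : int) (x : Qq) : j < 0 -> pcoef_div j x = 0.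
Proof. by case: j. Qed.

Lemma sum_shift (V : zmodType) (f : nat -> V) M :
  f 0%N = 0 -> f M = 0 -> \sum_(0 <= c < M) f c = \sum_(0 <= c < M) f c.+1.
Proof.
move=> f0 fM; have := big_nat_recr M 0 f (leq0n M) : _ = _ + _.
by rewrite fM addr0 => <-; rewrite big_nat_recl //= f0 add0r.
Qed.

(** * The polynomials G_b *)

(* [kpow], [nu], [hpoly] are polynomials in k = K^-1: [hpoly a n] is {h;a,n}, and
   [kpow j] is k^j, with the junk value 0 for j < 0, where p^(j) = 0 anyway. *)
Definition kpow (j : int) : {poly Qq} := if j is Posz n then 'X^n else 0.

Definition nu (e : int) : {poly Qq} := qq ^ e *: 'X^2 - (qq ^+ 2)%:P.

Definition hpoly (a : int) (n : nat) : {poly Qq} :=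
  \prod_(1 <= i < n.+1) ((qq ^+ (4 * i) - 1)^-1 *: nu (4 * a + 4 * i%:Z - 4)).

(* F P(k) = (qscale P)(k) F. *)
Definition qscale (P : {poly Qq}) : {poly Qq} := P \Po (qq ^- 2 *: 'X).

(** * q-Pascal relations for {h;a,n}, and the substitution k -> q^(-2) k *)

Lemma hpoly0 a : hpoly a 0 = 1.
Proof. by rewrite /hpoly big_geq. Qed.

Lemma hpolyS a n : hpoly a n.+1
  = (qq ^+ (4 * n.+1) - 1)^-1 *: (hpoly a n * nu (4 * a + 4 * n%:Z)).
Proof.
rewrite /hpoly big_nat_recr //= -scalerAr; congr (_ *: (_ * nu _)); lia.
Qed.

(** The numerators of {h;a-1,n+1} are those of {h;a,n} preceded by one new factor, and the
    denominators depend on the length only. With [hpolyS], both {h;a,n+1} and {h;a-1,n+1} become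
    {h;a,n} times a single factor. *)
Lemma hpoly_predS a n : hpoly (a - 1) n.+1
  = (qq ^+ (4 * n.+1) - 1)^-1 *: (hpoly a n * nu (4 * a - 4)).
Proof.
elim: n => [|n IH].
  by rewrite hpolyS !hpoly0; congr (_ *: (_ * nu _)); lia.
rewrite hpolyS {}IH [hpoly a n.+1]hpolyS -!scalerAl; congr (_ *: (_ *: _)).
by rewrite -!mulrA; congr (_ * _); rewrite mulrC; congr (nu _ * _); lia.
Qed.

(** The two extra factors share their constant term, so their difference is a multiple of k^2; its
    coefficient contains the last denominator. *)
Lemma hpoly_sub a n :
  hpoly a n.+1 - hpoly (a - 1) n.+1 = qq ^ (4 * a - 4) *: ('X^2 * hpoly a n).
Proof.
rewrite hpolyS hpoly_predS -scalerBr -mulrBr.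
have -> : nu (4 * a + 4 * n%:Z) - nu (4 * a - 4)
          = ((qq ^+ (4 * n.+1) - 1) * qq ^ (4 * a - 4)) *: 'X^2.
  rewrite /nu opprB addrA subrK -scalerBl; congr (_ *: _).
  have -> : 4 * a + 4 * n%:Z = (4 * n.+1)%N%:Z + (4 * a - 4) by lia.
  by rewrite qqD mulrBl mul1r.
rewrite -scalerAr scalerA mulrA mulVf; last exact: qq_expn_neq1.
by rewrite mul1r [_ * hpoly a n]mulrC.
Qed.

(** The weight q^(4n+4) cancels the k^2 terms of the two extra factors and leaves a constant, so the
    length drops without producing a power of k. *)
Lemma hpoly_pred a n : hpoly a n
  = qq ^- 2 *: (hpoly a n.+1 - qq ^+ (4 * n.+1) *: hpoly (a - 1) n.+1).
Proof.
have den_neq0 := qq_expn_neq1 (4 * n.+1) isT; have q2_neq0 := expf_neq0 2 qq_neq0.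
rewrite hpolyS hpoly_predS.
rewrite [qq ^+ (4 * n.+1) *: _]scalerA [X in X *: (hpoly a n * nu (4 * a - 4))]mulrC.
rewrite -[X in _ - X]scalerA -scalerBr scalerAr -mulrBr.
have -> : nu (4 * a + 4 * n%:Z) - qq ^+ (4 * n.+1) *: nu (4 * a - 4)
          = ((qq ^+ (4 * n.+1) - 1) * qq ^+ 2)%:P.
  rewrite /nu scalerBr scalerA.
  have -> : 4 * a + 4 * n%:Z = (4 * n.+1)%N%:Z + (4 * a - 4) by lia.
  rewrite qqD -!mul_polyC -exprnP; move: (qq ^+ _) (qq ^+ 2) (qq ^ _).
  by move: Qq => R *; ring.
rewrite mulrC mul_polyC !scalerA [X in X *: _](_ : _ = 1) ?scale1r //.
by rewrite -mulrA (mulKf den_neq0) (mulVf q2_neq0).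
Qed.

Lemma qqN (i : int) : qq ^ (- i) = (qq ^ i)^-1.
Proof. by rewrite -invr_expz. Qed.

Lemma qq_expz_neq0 (i : int) : qq ^ i != 0.
Proof. exact: expfz_neq0 qq_neq0. Qed.

Lemma qscaleD P Q : qscale (P + Q) = qscale P + qscale Q.
Proof. exact: comp_polyD. Qed.

Lemma qscaleM P Q : qscale (P * Q) = qscale P * qscale Q.
Proof. exact: comp_polyM. Qed.

Lemma qscaleZ c P : qscale (c *: P) = c *: qscale P.
Proof. exact: comp_polyZ. Qed.

Lemma qscale_nu e : qscale (nu e) = nu (e - 4).
Proof.
rewrite /qscale /nu comp_polyB comp_polyZ comp_polyC comp_Xn_poly exprZn scalerA.
congr (_ *: _ - _); rewrite qqD -exprVn -exprM; congr (_ * _).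
by rewrite exprVn exprnN.
Qed.

(** Each factor involves k only through k^2, which is multiplied by q^(-4); this lowers every
    exponent 4a+4i-4 by 4. *)
Lemma qscale_hpoly a n : qscale (hpoly a n) = hpoly (a - 1) n.
Proof.
elim: n => [|n IH]; first by rewrite !hpoly0 /qscale comp_polyC.
rewrite !hpolyS qscaleZ qscaleM IH qscale_nu; congr (_ *: (_ * nu _)); lia.
Qed.

Lemma qscale_kpow j : qscale (kpow j) = qq ^ (- (2 * j)) *: kpow j.
Proof.
case: j => [n|n]; last by rewrite /qscale comp_poly0 scaler0.
rewrite /qscale comp_Xn_poly exprZn; congr (_ *: _).
by rewrite -exprVn -exprM exprVn exprnN -PoszM.
Qed.

(** * Relations among the G_b, compared termwise in c *)

Section Coefficients.
Variable x : Qq.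
Local Notation p j := (pcoef_div j x).

(** The factor p (j - 1) makes this valid for every j: it vanishes at j = 0, where [kpow] breaks the
    rule k k^(j-1) = k^j. *)
Lemma pcoef_mulX s (H : {poly Qq}) (j : int) :
  'X * ((s * p (j - 1)) *: (H * kpow (j - 1))) = (s * p (j - 1)) *: (H * kpow j).
Proof.
rewrite -scalerAr mulrCA -!scalerA -[in kpow j](subrK 1 j); congr (_ *: _).
move: (j - 1) => [n|n]; last by rewrite pcoef_div_neg ?scale0r.
by rewrite /= addn1 exprS.
Qed.

Lemma pcoef_mulX2 s (H : {poly Qq}) (j : int) :
  'X^2 * ((s * p (j - 2)) *: (H * kpow (j - 2))) = (s * p (j - 2)) *: (H * kpow j).
Proof.
rewrite -scalerAr mulrCA -!scalerA -[in kpow j](subrK 2 j); congr (_ *: _).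
move: (j - 2) => [n|n]; last by rewrite pcoef_div_neg ?scale0r.
by rewrite /= addnC exprD.
Qed.

(* G_b; [M] merely truncates the sum over c, whose terms vanish once 2 c > n - b. *)
Definition gpoly (M : nat) (w : nat -> int) (a n b : int) : {poly Qq} :=
  \sum_(0 <= c < M) (qq ^ (w c - b * (n - b - 2 * c%:Z)) * p (n - b - 2 * c%:Z))
     *: (hpoly a c * kpow (n - b - 2 * c%:Z)).

Lemma qscale_gpoly M w a n b : qscale (gpoly M w a n b) =
  \sum_(0 <= c < M)
    (qq ^ (w c - (b + 2) * (n - b - 2 * c%:Z)) * p (n - b - 2 * c%:Z))
     *: (hpoly (a - 1) c * kpow (n - b - 2 * c%:Z)).
Proof.
rewrite /qscale /gpoly raddf_sum; apply: eq_bigr => c _ /=.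
rewrite -/(qscale _) qscaleZ qscaleM qscale_hpoly qscale_kpow -scalerAr scalerA.
congr (_ *: _); rewrite mulrAC -qqD; congr (qq ^ _ * _); ring.
Qed.

(** Each {h;a,c} is expanded by [hpoly_pred], then c is shifted by one. The new term c = 0 is zero
    because {h;a,0} = {h;a-1,0}; the term c = M is zero because its p has negative index. *)
Lemma gpoly_pred M (w : nat -> int) (a n b j0 : int) :
  (forall c, w c.+1 = w c + 4 * c%:Z + 7 - 2 * j0) -> n + 2 - b < 2 * M%:Z ->
  gpoly M w a n b = \sum_(0 <= c < M)
    (qq ^ (w c - 4 * c%:Z - 5 + 2 * j0 - b * (n + 2 - b - 2 * c%:Z))
       * p (n + 2 - b - 2 * c%:Z))
     *: ((hpoly a c - qq ^+ (4 * c) *: hpoly (a - 1) c) * kpow (n + 2 - b - 2 * c%:Z)).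
Proof.
move=> wS lt_nM; rewrite sum_shift; first last.
- by rewrite pcoef_div_neg ?mulr0 ?scale0r //; lia.
- by rewrite !hpoly0 muln0 expr0 scale1r subrr mul0r scaler0.
apply: eq_bigr => c _.
have -> : n + 2 - b - 2 * c.+1%:Z = n - b - 2 * c%:Z by lia.
rewrite {1}hpoly_pred -scalerAl scalerA; congr (_ *: _); rewrite mulrAC; congr (_ * _).
rewrite wS exprnN -qqD; congr (qq ^ _); lia.
Qed.

(** [qscale] changes both the scalar of k^j and {h;a,c}. By [hpoly_sub] the second change is a
    multiple of k^2 {h;a,c-1}, and shifting c brings it back to {h;a,c} with the same power of k. *)
Lemma qscale_gpoly_sub M w (a n b : int) : n - b < 2 * M%:Z ->
  qscale (gpoly M w a n b) - gpoly M w a n b = \sum_(0 <= c < M)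
    (((qq ^ (- (2 * (n - b - 2 * c%:Z))) - 1) * qq ^ (w c - b * (n - b - 2 * c%:Z)))
       * p (n - b - 2 * c%:Z)
     - qq ^ (w c.+1 - (b + 2) * (n - b - 2 * c%:Z - 2) + 4 * a - 4)
       * p (n - b - 2 * c%:Z - 2)) *: (hpoly a c * kpow (n - b - 2 * c%:Z)).
Proof.
move=> lt_nM; rewrite qscale_gpoly.
pose f c := (qq ^ (w c - (b + 2) * (n - b - 2 * c%:Z)) * p (n - b - 2 * c%:Z))
     *: ((hpoly a c - hpoly (a - 1) c) * kpow (n - b - 2 * c%:Z)).
have fS : \sum_(0 <= c < M) f c = \sum_(0 <= c < M)
    (qq ^ (w c.+1 - (b + 2) * (n - b - 2 * c%:Z - 2) + 4 * a - 4)
       * p (n - b - 2 * c%:Z - 2)) *: (hpoly a c * kpow (n - b - 2 * c%:Z)).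
  rewrite sum_shift /f; first last.
  - by rewrite pcoef_div_neg ?mulr0 ?scale0r //; lia.
  - by rewrite !hpoly0 subrr mul0r scaler0.
  apply: eq_bigr => c _; have -> : n - b - 2 * c.+1%:Z = n - b - 2 * c%:Z - 2 by lia.
  rewrite hpoly_sub -(pcoef_mulX2 (qq ^ _)).
  rewrite -[_ + 4 * a - 4]addrA [qq ^ (_ + (4 * a - 4))]qqD.
  rewrite -!mul_polyC !polyCM; move: (hpoly _ _) (kpow _) (qq ^ _) (qq ^ _) (p _).
  by move: Qq => R *; ring.
rewrite (eq_bigr _ (fun c _ => scalerBl _ _ _)) sumrB -fS -!sumrB.
apply: eq_bigr => c _; rewrite /f.
have -> : w c - (b + 2) * (n - b - 2 * c%:Z)
  = - (2 * (n - b - 2 * c%:Z)) + (w c - b * (n - b - 2 * c%:Z)) by ring.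
rewrite [qq ^ (- (2 * _) + _)]qqD -!mul_polyC.
move: (hpoly _ _) (hpoly _ _) (kpow _) (qq ^ _) (qq ^ _) (p _).
by move: Qq => R *; ring.
Qed.

Lemma gpoly_balance M (w : nat -> int) (a n b : int) :
  (forall c, w c.+1 = w c + 4 * c%:Z + 7 - 2 * (2 * a + n)) -> n + 1 - b < 2 * M%:Z ->
  (qq ^ b / (qq - qq^-1)) *: (qscale (gpoly M w a n (b - 1)) - gpoly M w a n (b - 1))
   + x *: ('X * gpoly M w a n b)
   + (qq ^ (- b) / (qq ^+ 2 - 1)) *: ('X^2 * gpoly M w a n (b + 1)) = 0.
Proof.
move=> wS lt_nM; rewrite qscale_gpoly_sub; last by lia.
rewrite /gpoly !mulr_sumr !scaler_sumr -!big_split /=; apply: big1 => c _.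
(* All three sums meet in the single polynomial {h;a,c} k^j, so a scalar identity for each c
   remains. *)
have [j Dj] : {j | j = n + 1 - b - 2 * c%:Z} by exists (n + 1 - b - 2 * c%:Z).
have -> : n - (b - 1) - 2 * c%:Z = j by lia.
have -> : n - b - 2 * c%:Z = j - 1 by lia.
have -> : n - (b + 1) - 2 * c%:Z = j - 2 by lia.
have -> : 'X * ((qq ^ (w c - b * (j - 1)) * p (j - 1)) *: (hpoly a c * kpow (j - 1)))
          = (qq ^ (w c - b * (j - 1)) * p (j - 1)) *: (hpoly a c * kpow j).
  exact: pcoef_mulX.
have -> : 'X^2 * ((qq ^ (w c - (b + 1) * (j - 2)) * p (j - 2)) *: (hpoly a c * kpow (j - 2)))
          = (qq ^ (w c - (b + 1) * (j - 2)) * p (j - 2)) *: (hpoly a c * kpow j).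
  exact: pcoef_mulX2.
rewrite !scalerA -!scalerDl [X in X *: _](_ : _ = 0) ?scale0r //.
(* The prescribed increment of w cancels every other occurrence of a and c. *)
have -> : w c.+1 - (b - 1 + 2) * (j - 2) + 4 * a - 4 = (w c - b * j) - j - j - j + 7.
  by rewrite wS (_ : n = j - 1 + b + 2 * c%:Z); [ring | lia].
have -> : w c - (b - 1) * j = (w c - b * j) + j by ring.
have -> : w c - b * (j - 1) = (w c - b * j) + b by ring.
have -> : w c - (b + 1) * (j - 2) = (w c - b * j) - j + b + b + 2 by ring.
have := pcoef_div_rec x j; rewrite !qintE.
have -> : 4 - 2 * j = 4 - j - j by ring.
have -> : - (j - 3) = 3 - j by ring.
have -> : - (2 * j) = - j - j by ring.
rewrite !(qqN, qqD) expr1z; have := qq_expn_neq1 2 isT; have := qq_neq0.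
have := qq_expz_neq0 (b * j); have := qq_expz_neq0 b; have := qq_expz_neq0 j.
move: (qq ^ b) (qq ^ j) (qq ^ w c) (qq ^ (b * j)) (p j) (p (j - 1)) (p (j - 2)).
move: x qq; move: Qq => R x0 q qb qj qw qbj p0 p1 p2.
move=> qj_neq0 qb_neq0 qbj_neq0 q_neq0 q2_neq1 rec.
(* The recursion is solved for x p (j - 1); what remains is a rational identity with p j and p (j -
   2) free. *)
have {rec} xp1 : x0 * p1 = (qj - qj^-1) / (q - q^-1) * p0 - q * (q * (q * q)) / qj / qj *
  ((qj / (q * (q * q)) - q * (q * q) / qj) / (q - q^-1)) * p2 by rewrite rec addrK.
rewrite [x0 * _]mulrCA xp1; field.
by rewrite qj_neq0 qbj_neq0 q2_neq1 qb_neq0 q_neq0.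
Qed.

(* The quadratic part of the exponent of q: e = 0 for tdot^(2m-1), e = 1 for tdot^(2m). *)
Definition wexp (e : int) (c : nat) : int := 2 * c%:Z * c%:Z - c%:Z - 2 * e * c%:Z.

(** The number 3 + e equals 2a + n for a = 2 - m and n = 2m - 1 + e, as [gpoly_balance] demands. *)
Lemma wexpS e c : wexp e c.+1 = wexp e c + 4 * c%:Z + 7 - 2 * (3 + e).
Proof. by rewrite /wexp -[c.+1]addn1 PoszD; ring. Qed.

(** Used at fixed c with H1 = {h;a,c}, H2 = {h;a-1,c} and e = q^(4c); the term in t comes from
    [gpoly_pred]. The second condition eliminates H2. *)
Lemma scale_comb_odd (R : comNzRingType) (s1 s2 t e u : R) (H1 H2 k : {poly R}) :
  s1 = u + t -> s2 = t * e ->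
  s1 *: (H1 * k) - s2 *: (H2 * k) - t *: ((H1 - e *: H2) * k) = u *: (H1 * k).
Proof. by move=> -> ->; rewrite -!mul_polyC; ring. Qed.

(** Here H2 survives: for a = 2 - m it is the {h;2-(m+1),c} belonging to tdot^(2m+1). *)
Lemma scale_comb_even (R : comNzRingType) (s1 s2 t e u v : R) (H1 H2 k : {poly R}) :
  s1 = v + t -> s2 + u = (t + v) * e ->
  s1 *: (H1 * k) - s2 *: (H2 * k) - t *: ((H1 - e *: H2) * k)
  = u *: (H2 * k) + v *: ((H1 - e *: H2) * k).
Proof.
move=> -> /(canRL (addrK _)) ->; rewrite -!mul_polyC; ring.
Qed.

Lemma gpoly_raise_odd M (m b : int) : 2 * m - b < 2 * M%:Z ->
  (qq - qq^-1)^-1 *: (qq ^ b *: gpoly M (wexp 0) (2 - m) (2 * m - 1) (b - 1)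
    - qq ^ (- b) *: qscale (gpoly M (wexp 0) (2 - m) (2 * m - 1) (b - 1)))
  - (qq ^ (- b) / (qq ^+ 2 - 1)) *: gpoly M (wexp 0) (2 - m) (2 * m - 1) (b + 1)
  = qint (2 * m) *: gpoly M (wexp 1) (2 - m) (2 * m) b.
Proof.
move=> lt_mM; rewrite qscale_gpoly.
rewrite [gpoly M _ _ _ (b + 1)](gpoly_pred _ _ _ _ _ _ (wexpS 0)); last by lia.
rewrite /gpoly scalerBr !scaler_sumr -[X in X - _ = _]sumrB -[LHS]sumrB.
apply: eq_bigr => c _.
have [j Dj] : {j | j = 2 * m - b - 2 * c%:Z} by exists (2 * m - b - 2 * c%:Z).
have -> : 2 * m - 1 - (b - 1) - 2 * c%:Z = j by lia.
have -> : 2 * m - 1 + 2 - (b + 1) - 2 * c%:Z = j by lia.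
have -> : 2 * m - b - 2 * c%:Z = j by lia.
have -> : b - 1 + 2 = b + 1 by ring.
have -> : wexp 1 c = wexp 0 c - c%:Z - c%:Z by rewrite /wexp; ring.
have -> : 2 * m = j + b + c%:Z + c%:Z by lia.
have -> : wexp 0 c - (b - 1) * j = wexp 0 c - b * j + j by ring.
have -> : wexp 0 c - (b + 1) * j = wexp 0 c - b * j - j by ring.
have -> : wexp 0 c - 4 * c%:Z - 5 + 2 * (3 + 0) - (b + 1) * j
  = wexp 0 c - b * j - j + 1 - c%:Z - c%:Z - c%:Z - c%:Z by ring.
rewrite !scalerA.
rewrite [qq ^+ (4 * c)]exprnP PoszM; have -> : 4%:Z * c%:Z = c%:Z + c%:Z + c%:Z + c%:Z by ring.
apply: scale_comb_odd; rewrite ?qintE !(qqN, qqD) ?expr1z;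
  have := qq_expz_neq0 (b * j); have := qq_expz_neq0 b; have := qq_expz_neq0 j;
  have := qq_expz_neq0 c; have := qq_expn_neq1 2 isT; have := qq_neq0;
  move: (qq ^ b) (qq ^ j) (qq ^ wexp 0 c) (qq ^ (b * j)) (qq ^ c) (p j);
  move: qq; move: Qq => R q qb qj qw qbj qc pj q_neq0 q2_neq1 qc_neq0 qj_neq0 qb_neq0 qbj_neq0.
all: field; rewrite -?expr2 oner_neq0.
all: by rewrite q_neq0 q2_neq1 qc_neq0 qj_neq0 qb_neq0 qbj_neq0.
Qed.

(** The tdot^(2m-1) sum on the right has powers of k too low by two, so it is also rewritten by
    [gpoly_pred] before terms are compared. *)
Lemma gpoly_raise_even M (m b : int) : 2 * m + 1 - b < 2 * M%:Z ->
  (qq - qq^-1)^-1 *: (qq ^ b *: gpoly M (wexp 1) (2 - m) (2 * m) (b - 1)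
    - qq ^ (- b) *: qscale (gpoly M (wexp 1) (2 - m) (2 * m) (b - 1)))
  - (qq ^ (- b) / (qq ^+ 2 - 1)) *: gpoly M (wexp 1) (2 - m) (2 * m) (b + 1)
  = qint (2 * m + 1) *: gpoly M (wexp 0) (1 - m) (2 * m + 1) b
    + qint (2 * m) *: gpoly M (wexp 0) (2 - m) (2 * m - 1) b.
Proof.
move=> lt_mM; rewrite qscale_gpoly.
rewrite [gpoly M _ _ (2 * m) (b + 1)](gpoly_pred _ _ _ _ _ _ (wexpS 1)); last by lia.
rewrite [gpoly M _ _ (2 * m - 1) b](gpoly_pred _ _ _ _ _ _ (wexpS 0)); last by lia.
rewrite /gpoly scalerBr !scaler_sumr -[X in X - _ = _]sumrB -[LHS]sumrB -[RHS]big_split.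
apply: eq_bigr => c _ /=.
have [j Dj] : {j | j = 2 * m + 1 - b - 2 * c%:Z} by exists (2 * m + 1 - b - 2 * c%:Z).
have -> : 2 * m - (b - 1) - 2 * c%:Z = j by lia.
have -> : 2 * m + 2 - (b + 1) - 2 * c%:Z = j by lia.
have -> : 2 * m - 1 + 2 - b - 2 * c%:Z = j by lia.
have -> : 2 * m + 1 - b - 2 * c%:Z = j by lia.
have -> : b - 1 + 2 = b + 1 by ring.
have -> : 2 - m - 1 = 1 - m by ring.
have -> : wexp 1 c = wexp 0 c - c%:Z - c%:Z by rewrite /wexp; ring.
have -> : 2 * m = j + b + c%:Z + c%:Z - 1 by lia.
have -> : wexp 0 c - c%:Z - c%:Z - (b - 1) * j
  = wexp 0 c - b * j + j - c%:Z - c%:Z by ring.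
have -> : wexp 0 c - c%:Z - c%:Z - (b + 1) * j
  = wexp 0 c - b * j - j - c%:Z - c%:Z by ring.
have -> : wexp 0 c - c%:Z - c%:Z - 4 * c%:Z - 5 + 2 * (3 + 1) - (b + 1) * j
  = wexp 0 c - b * j - j + 3 - c%:Z - c%:Z - c%:Z - c%:Z - c%:Z - c%:Z by ring.
have -> : wexp 0 c - 4 * c%:Z - 5 + 2 * (3 + 0) - b * j
  = wexp 0 c - b * j + 1 - c%:Z - c%:Z - c%:Z - c%:Z by ring.
rewrite subrK !scalerA.
rewrite [qq ^+ (4 * c)]exprnP PoszM; have -> : 4%:Z * c%:Z = c%:Z + c%:Z + c%:Z + c%:Z by ring.
apply: scale_comb_even; rewrite ?qintE !(qqN, qqD) ?expr1z;
  have := qq_expz_neq0 (b * j); have := qq_expz_neq0 b; have := qq_expz_neq0 j;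
  have := qq_expz_neq0 c; have := qq_expn_neq1 2 isT; have := qq_neq0;
  move: (qq ^ b) (qq ^ j) (qq ^ wexp 0 c) (qq ^ (b * j)) (qq ^ c) (p j);
  move: qq; move: Qq => R q qb qj qw qbj qc pj q_neq0 q2_neq1 qc_neq0 qj_neq0 qb_neq0 qbj_neq0.
all: field; rewrite -?expr2 oner_neq0.
all: by rewrite q_neq0 q2_neq1 qc_neq0 qj_neq0 qb_neq0 qbj_neq0.
Qed.

End Coefficients.

(** * Scalar identities and rearrangement of finite sums *)

Lemma qintS_l (n : int) : qint (n + 1) = qq ^ n + qq^-1 * qint n.
Proof.
rewrite !qintE !(qqN, qqD) expr1z.
have := qq_expz_neq0 n; have := qq_expn_neq1 2 isT; have := qq_neq0.
move: (qq ^ n) qq; move: Qq => R q qn q_neq0 q2_neq1 qn_neq0; field.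
by rewrite -?expr2 q2_neq1 qn_neq0 q_neq0.
Qed.

Lemma qintS_r (n : int) : qint (n + 1) = qq ^ (- n) + qq * qint n.
Proof.
rewrite !qintE !(qqN, qqD) expr1z.
have := qq_expz_neq0 n; have := qq_expn_neq1 2 isT; have := qq_neq0.
move: (qq ^ n) qq; move: Qq => R q qn q_neq0 q2_neq1 qn_neq0; field.
by rewrite -?expr2 q2_neq1 qn_neq0 q_neq0.
Qed.

Lemma bin_double c : 'C(2 * c, 2)%:Z = 2 * c%:Z * c%:Z - c%:Z.
Proof.
rewrite bin2; have -> : ((2 * c) * (2 * c).-1)%N = (c * (2 * c).-1).*2 by rewrite -mul2n mulnA.
by rewrite doubleK; case: c => // c; nia.
Qed.

Lemma gpoly_eq0 x M w (a n b : int) : n < b -> gpoly x M w a n b = 0.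
Proof.
move=> lt_nb; apply: big1 => c _.
by rewrite pcoef_div_neg ?mulr0 ?scale0r //; lia.
Qed.

Lemma sum_widen (V : zmodType) (f : nat -> V) m n : (m <= n)%N ->
  (forall i, (m <= i)%N -> f i = 0) -> \sum_(0 <= i < n) f i = \sum_(0 <= i < m) f i.
Proof.
move=> le_mn f0; rewrite (big_cat_nat (leq0n m) le_mn) /=.
rewrite [X in _ + X]big_nat_cond [X in _ + X]big1 ?addr0 // => i.
by rewrite andbT => /andP[/f0].
Qed.

Lemma sum_triangle (V : zmodType) (f : nat -> nat -> V) n :
  \sum_(0 <= b < n) \sum_(0 <= a < b.+1) f a (b - a)%N
  = \sum_(0 <= a < n) \sum_(0 <= d < n - a) f a d.
Proof.
elim: n => [|n IH]; first by rewrite !big_geq.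
rewrite big_nat_recr //= IH [RHS]big_nat_recr //= subSnn big_nat1.
rewrite [X in _ + X]big_nat_recr //= subnn addrA; congr (_ + _).
rewrite -big_split /= [LHS]big_nat_cond [RHS]big_nat_cond; apply: eq_bigr => a.
by rewrite andbT => /andP[_ lt_an]; rewrite subSn ?big_nat_recr // ltnW.
Qed.

Lemma gpoly_widen x M N w (a n b : int) : (M <= N)%N -> n - b < 2 * M%:Z ->
  gpoly x N w a n b = gpoly x M w a n b.
Proof.
move=> le_MN lt_nM; apply: sum_widen => // c le_Mc.
by rewrite pcoef_div_neg ?mulr0 ?scale0r //; lia.
Qed.

(* To be used with u = q^(-2a) and th = q^(-a d). *)
Lemma raise_combination (R : comNzRingType) (th u B B' di e ka : R)
    (Gm sGm XG X2 Gp S : {poly R}) :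
  (B * di) *: (sGm - Gm) + ka *: XG + (B' * e) *: (X2 * Gp) = 0 ->
  di *: (B *: Gm - B' *: sGm) - (B' * e) *: Gp = S ->
  (th * (B - B * u) * di) *: Gm + (th * (B * u - B') * di) *: sGm
    + (u * ka * th) *: XG + (th * B' * e) *: ((u *: X2 - 1) * Gp) = th *: S.
Proof.
(* The vanishing relation [bal], multiplied by th u, is added to the right-hand side. *)
move=> bal <-; rewrite -[RHS]addr0 -(scaler0 _ (th * u)) -bal -!mul_polyC; ring.
Qed.

(** * The algebra U *)

(** The polynomial in k produced when F crosses check-E^(n+1), see [F_Echkdiv]. *)
Definition fe_poly (n : nat) : {poly Qq} :=
  (qq ^+ 2 - 1)^-1 *: (qq ^ (- (3 * n%:Z)) *: 'X^2 - (qq ^ (- n%:Z))%:P).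

Section Algebra.
Variables (A : algType Qq) (E F K Kinv : A).
Hypothesis rel : Uq_relations E F K Kinv.

Local Notation Ec := (Echk E Kinv).
Local Notation Ed := (Echkdiv E Kinv).
Local Notation Fd := (Fdiv F).
Local Notation ev := (horner_alg Kinv).

(** * Commutation rules for the order check-E, K^-1, F *)

Lemma F_Kinv : F * Kinv = qq ^- 2 *: (Kinv * F).
Proof.
have [KKi KiK _ _ KF] := rel.
by rewrite -[LHS]mul1r -KiK mulrA -[Kinv * K * F]mulrA KF -scalerAr -!scalerAl -!mulrA KKi mulr1.
Qed.

Lemma Kinv_E : Kinv * E = qq ^- 2 *: (E * Kinv).
Proof.
have [KKi KiK _ KE _] := rel.
have -> : E * Kinv = qq ^+ 2 *: (Kinv * E).
  by rewrite -[LHS]mul1r -KiK mulrA -[Kinv * K * E]mulrA KE -scalerAr -!scalerAl -!mulrA KKi mulr1.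
by rewrite scalerA mulVf ?scale1r // expf_neq0 // qq_neq0.
Qed.

Lemma Kinv_Echk : Kinv * Ec = qq ^- 2 *: (Ec * Kinv).
Proof. by rewrite /Echk -scalerAr mulrA Kinv_E -!scalerAl !scalerA mulrC. Qed.

(** The K^-1 inside check-E turns K - K^-1 into 1 - K^-2, so no positive power of K arises and
    polynomials in k = K^-1 suffice. *)
Lemma F_Echk : F * Ec = qq ^- 2 *: (Ec * F) + (qq ^+ 2 - 1)^-1 *: (Kinv ^+ 2 - 1).
Proof.
have [KKi _ EF _ _] := rel.
have FE : F * E = E * F - (qq - qq^-1)^-1 *: (K - Kinv) by rewrite -EF opprB addrC subrK.
rewrite /Echk -scalerAr mulrA FE mulrBl -mulrA F_Kinv -!scalerAl -scalerAr mulrBl KKi -expr2.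
rewrite scalerBr !scalerA mulrA -[Kinv ^+ 2 - 1]opprB scalerN [qq^-1 / _]mulrC.
congr (_ - _ *: _); rewrite -invfM; congr (_^-1).
by rewrite mulrBr (mulfV qq_neq0) expr2.
Qed.

Lemma Kinv_EchkX n : Kinv * Ec ^+ n = qq ^ (- (2 * n%:Z)) *: (Ec ^+ n * Kinv).
Proof.
elim: n => [|n IH]; first by rewrite mulr1 mul1r scale1r.
rewrite exprSr mulrA IH -scalerAl -!mulrA Kinv_Echk -scalerAr scalerA.
congr (_ *: _); rewrite exprnN -qqD; congr (qq ^ _); lia.
Qed.

Lemma horner_algZ c P : ev (c *: P) = c *: ev P.
Proof. by rewrite linearZ /= mulr_algl. Qed.

Lemma F_ev P : F * ev P = ev (qscale P) * F.
Proof.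
elim/poly_ind: P => [|P c IH].
  by rewrite /qscale comp_poly0 raddf0 mulr0 mul0r.
have evXE : F * ev 'X = ev (qscale 'X) * F.
  by rewrite /qscale comp_polyX horner_algZ horner_algX F_Kinv scalerAl.
have evCE : F * ev c%:P = ev (qscale c%:P) * F.
  by rewrite /qscale comp_polyC horner_algC -[RHS]scalerAl mul1r -scalerAr mulr1.
by rewrite qscaleD qscaleM !rmorphD !rmorphM mulrDr mulrDl evCE mulrA IH -!mulrA evXE.
Qed.

(** Induction on n. The k^2 and constant coefficients are collected into [n+1] by [qintS_l] and
    [qintS_r] respectively. At n = 0 the index [n.-1] is harmless because [0] = 0. *)
Lemma F_EchkX n : F * Ec ^+ n = qq ^ (- (2 * n%:Z)) *: (Ec ^+ n * F)
  + qint n%:Z *: (Ec ^+ n.-1 * ev (fe_poly n.-1)).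
Proof.
move: (Echk E Kinv) Kinv_Echk F_Echk => X Kinv_X F_X.
elim: n => [|n IH].
  by rewrite qint0 scale0r addr0 scale1r mulr1 mul1r.
have evP k : ev (fe_poly k) = (qq ^+ 2 - 1)^-1 *:
    (qq ^ (- (3 * k%:Z)) *: Kinv ^+ 2 - (qq ^ (- k%:Z))%:A).
  by rewrite /fe_poly horner_algZ rmorphB /= horner_algZ rmorphXn /= horner_algX horner_algC.
have K2_X : Kinv ^+ 2 * X = qq ^ (- 4) *: (X * Kinv ^+ 2).
  rewrite [in LHS]expr2 -[LHS]mulrA Kinv_X -scalerAr [Kinv * (X * _)]mulrA Kinv_X -scalerAl.
  by rewrite scalerA exprnN -qqD -mulrA.
have XS : qint n%:Z *: (X ^+ n.-1 * ev (fe_poly n.-1) * X)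
  = qint n%:Z *: (X ^+ n * ((qq ^+ 2 - 1)^-1 *:
      (qq ^ (- (3 * n%:Z) - 1) *: Kinv ^+ 2 - (qq ^ (1 - n%:Z))%:A))).
  case: n {IH} => [|n]; first by rewrite qint0 !scale0r.
  congr (_ *: _); rewrite evP /= [X ^+ n.+1]exprSr -!mulrA; congr (_ * _).
  rewrite -scalerAl -scalerAr; congr (_ *: _).
  rewrite mulrBl mulrBr -!scalerAl -!scalerAr mul1r mulr1 K2_X scalerA -qqD.
  by congr (qq ^ _ *: _ - qq ^ _ *: _); lia.
have XF : X ^+ n * F * X
    = qq ^- 2 *: (X ^+ n * X * F) + (qq ^+ 2 - 1)^-1 *: (X ^+ n * (Kinv ^+ 2 - 1)).
  by rewrite -mulrA F_X mulrDr -!scalerAr mulrA.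
rewrite [X ^+ n.+1]exprSr mulrA IH mulrDl -!scalerAl XS XF scalerDr scalerA -addrA.
congr (_ + _); first by rewrite exprnN -qqD; congr (qq ^ _ *: _); lia.
rewrite evP /= -!scalerAr !mulrBr -!scalerAr mulr1.
rewrite !scalerBr !scalerA addrACA -!scalerDl.
have -> : n.+1%:Z = n%:Z + 1 by lia.
have -> : - (2 * n%:Z) = - n%:Z - n%:Z by ring.
have -> : - (3 * n%:Z) = - n%:Z - n%:Z - n%:Z by ring.
congr (_ *: _ + _); last rewrite -opprD -scalerDl; last congr (- (_ *: _)).
1: rewrite qintS_l.
2: rewrite qintS_r.
all: rewrite !(qqN, qqD) ?expr1z.
all: have := qq_expz_neq0 n; have := qq_expn_neq1 2 isT; have := qq_neq0.
all: move: (qint n) qq; move: Qq => R qintn q q_neq0 q2_neq1 qn_neq0; field.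
all: by rewrite qn_neq0 q2_neq1 ?q_neq0.
Qed.

Lemma F_Echkdiv n : F * Ed n.+1
  = qq ^ (- (2 * n.+1%:Z)) *: (Ed n.+1 * F) + Ed n * ev (fe_poly n).
Proof.
rewrite /Echkdiv -scalerAr F_EchkX scalerDr -!scalerAl; congr (_ + _).
  by rewrite !scalerA mulrC.
by rewrite scalerA qfactS invfM mulrAC mulVf ?mul1r // qint_nat_neq0.
Qed.

Lemma mul_dpow (X : A) n : X * ((qfact n)^-1 *: X ^+ n)
  = qint n.+1%:Z *: ((qfact n.+1)^-1 *: X ^+ n.+1).
Proof.
rewrite -scalerAr -exprS scalerA qfactS invfM mulrA.
by rewrite (mulfV (qint_nat_neq0 n.+1 isT)) mul1r.
Qed.

Lemma Echk_Echkdiv n : Ec * Ed n = qint n.+1%:Z *: Ed n.+1.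
Proof. exact: mul_dpow. Qed.

Lemma F_Fdiv n : F * Fd n = qint n.+1%:Z *: Fd n.+1.
Proof. exact: mul_dpow. Qed.

Lemma Kinv_Echkdiv n : Kinv * Ed n = qq ^ (- (2 * n%:Z)) *: (Ed n * Kinv).
Proof. by rewrite /Echkdiv -scalerAr Kinv_EchkX -scalerAl !scalerA mulrC. Qed.

(** * Left multiplication by t on triangular expansions *)

Definition pbw (a : nat) (P : {poly Qq}) (d : nat) : A := Ed a * ev P * Fd d.

Lemma pbwD a P Q d : pbw a (P + Q) d = pbw a P d + pbw a Q d.
Proof. by rewrite /pbw rmorphD mulrDr mulrDl. Qed.

Lemma pbwZ a c P d : pbw a (c *: P) d = c *: pbw a P d.
Proof. by rewrite /pbw horner_algZ -(scalerAr c) -(scalerAl c). Qed.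

Lemma pbw0 a d : pbw a 0 d = 0.
Proof. by rewrite /pbw rmorph0 mulr0 mul0r. Qed.

Definition pbw_lower (a : nat) (P : {poly Qq}) (d : nat) : A :=
  if a is a'.+1 then pbw a' (fe_poly a' * P) d else 0.

(** In order: check-E raises a; F passes through to the right, rescaling P and raising d; K^-1 moves
    into the middle; and the remainder of F crossing check-E^(a) lowers a. *)
Lemma tU_pbw kappa a P d : tU E F Kinv kappa * pbw a P d
  = qint a.+1%:Z *: pbw a.+1 P d
    + (qq ^ (- (2 * a%:Z)) * qint d.+1%:Z) *: pbw a (qscale P) d.+1
    + (qq ^ (- (2 * a%:Z)) * kappa) *: pbw a ('X * P) d
    + pbw_lower a P d.
Proof.
rewrite /tU [LHS]mulrDl [X in X + _ = _]mulrDl.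
have -> : Ec * pbw a P d = qint a.+1%:Z *: pbw a.+1 P d.
  by rewrite /pbw !mulrA Echk_Echkdiv -!scalerAl.
have -> : kappa *: Kinv * pbw a P d = (qq ^ (- (2 * a%:Z)) * kappa) *: pbw a ('X * P) d.
  rewrite -scalerAl /pbw !mulrA Kinv_Echkdiv -!scalerAl scalerA mulrC rmorphM /=.
  by rewrite horner_algX !mulrA.
have low : F * (ev P * Fd d) = qint d.+1%:Z *: (ev (qscale P) * Fd d.+1).
  by rewrite mulrA F_ev -mulrA F_Fdiv -scalerAr.
have -> : F * pbw a P d = (qq ^ (- (2 * a%:Z)) * qint d.+1%:Z) *: pbw a (qscale P) d.+1
    + pbw_lower a P d.
  rewrite /pbw -[Ed a * _ * _]mulrA mulrA; case: a => [|a] /=.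
    by rewrite addr0 {1 2}/Echkdiv qfact0 invr1 scale1r mulr1 mul1r mul1r low.
  rewrite F_Echkdiv mulrDl -scalerAl -[Ed a.+1 * F * _]mulrA low -scalerAr scalerA.
  by rewrite /pbw rmorphM /= !mulrA.
have sumE (u v x y : A) : u + v + x + y = x + u + y + v.
  by rewrite [u + v + x]addrAC [u + x]addrC [LHS]addrAC.
exact: sumE.
Qed.

Definition pbw_sum (M : nat) (X : nat -> nat -> {poly Qq}) : A :=
  \sum_(0 <= a < M.+1) \sum_(0 <= d < M.+1) pbw a (X a d) d.

(** Each of the terms of [tU_pbw] that moves an index is re-indexed. The predecessors at 0 carry a
    factor [0], and the vanishing of X from M on removes the upper boundary terms. *)
Lemma tU_pbw_sum kappa M X :
  (forall a d, ((M <= a) || (M <= d))%N -> X a d = 0) ->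
  tU E F Kinv kappa * pbw_sum M X = pbw_sum M (fun a d =>
    qint a%:Z *: X a.-1 d + (qq ^ (- (2 * a%:Z)) * qint d%:Z) *: qscale (X a d.-1)
    + (qq ^ (- (2 * a%:Z)) * kappa) *: ('X * X a d) + fe_poly a * X a.+1 d).
Proof.
move=> X0; rewrite /pbw_sum mulr_sumr.
under eq_bigr => a _ do [rewrite mulr_sumr; under eq_bigr => d _ do rewrite tU_pbw].
under [RHS]eq_bigr => a _ do [under eq_bigr => d _ do rewrite !pbwD !pbwZ].
under eq_bigr => a _ do rewrite !big_split /=.
under [RHS]eq_bigr => a _ do rewrite !big_split /=.
rewrite !big_split /=; congr (_ + _ + _ + _).
- rewrite [RHS]sum_shift //.
  + by apply: big1 => d _; rewrite qint0 scale0r.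
  + by apply: big1 => d _; rewrite X0 ?leqnn // pbw0 scaler0.
- apply: eq_bigr => a _; rewrite [RHS]sum_shift //.
  + by rewrite qint0 mulr0 scale0r.
  + by rewrite X0 ?leqnn ?orbT // /qscale comp_poly0 pbw0 scaler0.
- rewrite [LHS]sum_shift //.
  + by apply: big1 => d _.
  + by apply: big1 => d _; rewrite X0 ?leqnSn // /= mulr0 pbw0.
Qed.

Definition twist (G : int -> {poly Qq}) (i d : nat) : {poly Qq} :=
  qq ^ (- (i%:Z * d%:Z)) *: G (i%:Z + d%:Z).

(** This replaces an identity in U by two polynomial identities for each b = a + d, through
    [raise_combination]. *)
Lemma tU_twist kappa M (G S : int -> {poly Qq}) :
  (forall b, M%:Z <= b -> G b = 0) ->
  (forall b, 0 <= b ->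
    (qq ^ b / (qq - qq^-1)) *: (qscale (G (b - 1)) - G (b - 1))
    + kappa *: ('X * G b) + (qq ^ (- b) / (qq ^+ 2 - 1)) *: ('X^2 * G (b + 1)) = 0) ->
  (forall b, 0 <= b ->
    (qq - qq^-1)^-1 *: (qq ^ b *: G (b - 1) - qq ^ (- b) *: qscale (G (b - 1)))
    - (qq ^ (- b) / (qq ^+ 2 - 1)) *: G (b + 1) = S b) ->
  tU E F Kinv kappa * pbw_sum M (twist G) = pbw_sum M (twist S).
Proof.
move=> G0 bal raise; rewrite tU_pbw_sum => [|a d /orP le_M]; last first.
  by rewrite /twist G0 ?scaler0 //; case: le_M; lia.
apply: eq_bigr => a _; apply: eq_bigr => d _; congr (pbw a _ d); rewrite /twist.
set b := a%:Z + d%:Z; have b_ge0 : 0 <= b by rewrite /b; lia.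
rewrite -(raise_combination _ (qq ^ (- (a%:Z * d%:Z))) (qq ^ (- (2 * a%:Z)))
  _ _ _ _ _ _ _ _ _ _ _ (bal b b_ge0) (raise b b_ge0)).
have add4 (V : zmodType) (u1 u2 u3 u4 v1 v2 v3 v4 : V) :
  u1 = v1 -> u2 = v2 -> u3 = v3 -> u4 = v4 -> u1 + u2 + u3 + u4 = v1 + v2 + v3 + v4.
  by move=> -> -> -> ->.
have qd_neq0 := qq_expz_neq0 d; have qa_neq0 := qq_expz_neq0 a.
have q_neq0 := qq_neq0; have q2_neq1 := qq_expn_neq1 2 isT.
apply: add4.
(* At a = 0 both coefficients vanish, by [0] = 0 and u = 1, so G at b - 1 need not match. *)
- case: a @b {b_ge0} qa_neq0 => [|a] b qa_neq0.
    by rewrite qint0 scale0r /b add0r !mulr0 oppr0 expr0z mulr1 subrr mulr0 mul0r scale0r.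
  have -> : a%:Z + d%:Z = b - 1 by rewrite /b; lia.
  rewrite scalerA; apply: (congr1 (fun u => u *: _)).
  have -> : - (a%:Z * d%:Z) = - (a.+1%:Z * d%:Z) + d%:Z by lia.
  have -> : - (2 * a.+1%:Z) = - a.+1%:Z - a.+1%:Z by ring.
  rewrite /b qintE !(qqN, qqD).
  move: qd_neq0 qa_neq0 q_neq0 q2_neq1 (qq_expz_neq0 (a.+1%:Z * d%:Z)).
  move: (qq ^ d) (qq ^ a.+1) (qq ^ (a.+1%:Z * d%:Z)) qq.
  move: Qq => R qd qa qad q qd_neq0 qa_neq0 q_neq0 q2_neq1 qad_neq0; field.
  by rewrite -expr2 q_neq0 q2_neq1 qa_neq0 qad_neq0.
(* At d = 0 one has b = a, hence q^b u = q^(-b), and again both coefficients vanish. *)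
- case: d @b {b_ge0} qd_neq0 => [|d] b qd_neq0.
    have -> : qq ^ b * qq ^ (- (2 * a%:Z)) - qq ^ (- b) = 0.
      by rewrite -qqD; apply/eqP; rewrite subr_eq0; apply/eqP; congr (qq ^ _); rewrite /b; lia.
    by rewrite qint0 (mulr0 (qq ^ _)) scale0r (mulr0 (qq ^ _)) (mul0r (_^-1)) scale0r.
  have -> : a%:Z + d%:Z = b - 1 by rewrite /b; lia.
  rewrite qscaleZ scalerA; apply: (congr1 (fun u => u *: _)).
  have -> : - (a%:Z * d%:Z) = - (a%:Z * d.+1%:Z) + a%:Z by lia.
  have -> : - (2 * a%:Z) = - a%:Z - a%:Z by ring.
  rewrite /b qintE !(qqN, qqD).
  move: qd_neq0 qa_neq0 q_neq0 q2_neq1 (qq_expz_neq0 (a%:Z * d.+1%:Z)).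
  move: (qq ^ d.+1) (qq ^ a) (qq ^ (a%:Z * d.+1%:Z)) qq.
  move: Qq => R qd qa qad q qd_neq0 qa_neq0 q_neq0 q2_neq1 qad_neq0; field.
  by rewrite -expr2 q_neq0 q2_neq1 qd_neq0 qa_neq0 qad_neq0.
- by rewrite -scalerAr scalerA.
- have -> : a.+1%:Z + d%:Z = b + 1 by rewrite /b; lia.
  rewrite -scalerAr scalerAl /fe_poly scalerA.
  have -> : - (a.+1%:Z * d%:Z) = - (a%:Z * d%:Z) - d%:Z by lia.
  have -> : - (3 * a%:Z) = - a%:Z - a%:Z - a%:Z by ring.
  have -> : - (2 * a%:Z) = - a%:Z - a%:Z by ring.
  have -> : - b = - a%:Z - d%:Z by rewrite /b; lia.
  rewrite !qqD -!mul_polyC.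
  move: (qq ^ (- a%:Z)) (qq ^ (- d%:Z)) (qq ^ (- (a%:Z * d%:Z))) ((_ - 1)^-1) (G _).
  by clear; move: Qq => R *; ring.
Qed.

Lemma twistD G S i d : twist (fun b => G b + S b) i d = twist G i d + twist S i d.
Proof. exact: scalerDr. Qed.

Lemma twistZ c G i d : twist (fun b => c *: G b) i d = c *: twist G i d.
Proof. by rewrite /twist !scalerA mulrC. Qed.

Lemma pbw_sum_twistD M G S :
  pbw_sum M (twist (fun b => G b + S b)) = pbw_sum M (twist G) + pbw_sum M (twist S).
Proof.
rewrite /pbw_sum -big_split; apply: eq_bigr => a _ /=.
by rewrite -big_split; apply: eq_bigr => d _; rewrite twistD pbwD.
Qed.

Lemma pbw_sum_twistZ M c G :
  pbw_sum M (twist (fun b => c *: G b)) = c *: pbw_sum M (twist G).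
Proof.
rewrite /pbw_sum scaler_sumr; apply: eq_bigr => a _ /=.
by rewrite scaler_sumr; apply: eq_bigr => d _; rewrite twistZ pbwZ.
Qed.

(** * The right-hand sides and their recursion under t *)

Section Formulas.
Variables (kappa : Qq) (M : nat).

(** The candidate for tdot^(2m-1). Integer m lets the recursion start at m = 0. *)
Definition odd_elt (m : int) : A :=
  pbw_sum M (twist (gpoly kappa M (wexp 0) (2 - m) (2 * m - 1))).

Definition even_elt (m : int) : A :=
  pbw_sum M (twist (gpoly kappa M (wexp 1) (2 - m) (2 * m))).

Local Notation t := (tU E F Kinv kappa).

Lemma tU_odd_elt (m : int) : 2 * m + 1 < M%:Z -> t * odd_elt m = qint (2 * m) *: even_elt m.
Proof.
move=> lt_mM; rewrite -pbw_sum_twistZ; apply: tU_twist => b b_ge.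
- by rewrite gpoly_eq0 //; lia.
- apply: gpoly_balance; last by lia.
  by move=> c; rewrite wexpS; congr (_ - 2 * _); ring.
- by apply: gpoly_raise_odd; lia.
Qed.

Lemma tU_even_elt (m : int) : 2 * m + 1 < M%:Z ->
  t * even_elt m = qint (2 * m + 1) *: odd_elt (m + 1) + qint (2 * m) *: odd_elt m.
Proof.
move=> lt_mM; rewrite -!pbw_sum_twistZ -pbw_sum_twistD; apply: tU_twist => b b_ge.
- by rewrite gpoly_eq0 //; lia.
- apply: gpoly_balance; last by lia.
  by move=> c; rewrite wexpS; congr (_ - 2 * _); ring.
- have -> : 2 - (m + 1) = 1 - m by ring.
  have -> : 2 * (m + 1) - 1 = 2 * m + 1 by ring.
  by apply: gpoly_raise_even; lia.
Qed.

(** Only a = d = c = 0 contributes, since every other p has negative index. *)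
Lemma even_elt0 : (0 < M)%N -> even_elt 0 = 1.
Proof.
move=> M_gt0; rewrite /even_elt /pbw_sum big_nat_recl //= [X in X + _]big_nat_recl //=.
have G0 i d : (0 < i + d)%N -> twist (gpoly kappa M (wexp 1) (2 - 0) (2 * 0)) i d = 0.
  by move=> gt0; rewrite /twist gpoly_eq0 ?scaler0 //; lia.
rewrite [X in _ + X + _]big1 ?addr0 => [|d _]; last by rewrite G0 ?pbw0.
rewrite [X in _ + X]big1 ?addr0 => [|i _]; last first.
  by apply: big1 => d _; rewrite G0 ?pbw0.
have -> : twist (gpoly kappa M (wexp 1) (2 - 0) (2 * 0)) 0 0 = 1.
  rewrite /twist scale1r (@gpoly_widen _ 1) //.
  rewrite /gpoly big_nat1 hpoly0 mul1r /= qfact0 divr1 (hornerC 1 kappa) mulr1.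
  by rewrite scale1r.
by rewrite /pbw /Echkdiv /Fdiv qfact0 invr1 !scale1r rmorph1 !mulr1.
Qed.

End Formulas.

(** * Identification of the divided powers with these elements *)

Lemma comm_subr_alg (t : A) (c : Qq) : GRing.comm t (t - c%:A).
Proof. by apply: commrB => //; rewrite /GRing.comm mulr_algl mulr_algr. Qed.

(** The two new outer factors are t + c and t - c with c = [2k+2]; all factors commute, so the outer
    two combine to t^2 - c^2. *)
Lemma tdot_oddS kappa k : tdot_odd E F Kinv kappa k.+1
  = (qint (2 * k.+1%:Z) * qint (2 * k.+1%:Z + 1))^-1 *:
    ((tU E F Kinv kappa ^+ 2 - (qint (2 * k.+1%:Z) ^+ 2)%:A) * tdot_odd E F Kinv kappa k).
Proof.
rewrite /tdot_odd; move: (tU E F Kinv kappa) => t.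
have -> : (2 * k.+1).+1 = (2 * k).+3 by lia.
rewrite big_nat_recl // big_nat_recr //=.
have -> : 2 * (0%:Z - k.+1%:Z) = - (2 * k.+1%:Z) by lia.
have -> : 2 * ((2 * k).+2%:Z - k.+1%:Z) = 2 * k.+1%:Z by lia.
rewrite qintN; set c := qint (2 * k.+1%:Z).
under eq_bigr => i _.
  have -> : i.+1%:Z - k.+1%:Z = i%:Z - k%:Z by lia.
  over.
set P := \prod_(0 <= i < _) _.
have tP : GRing.comm P (t - c%:A).
  apply: commr_sym; rewrite /P big_seq; elim/big_ind: _ => [|u v|i _]; first exact: commr1.
    exact: commrM.
  apply: commrB; last by rewrite /GRing.comm mulr_algl mulr_algr.
  exact/commr_sym/comm_subr_alg.
have -> : (t - (- c)%:A) * (P * (t - c%:A)) = (t ^+ 2 - (c ^+ 2)%:A) * P.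
  rewrite tP mulrA; congr (_ * _); rewrite scaleNr opprK.
  rewrite mulrBr mulr_algr mulrDl mulr_algl scalerDr scalerA -!expr2 opprD addrA.
  by rewrite addrK.
rewrite -scalerAr scalerA !qfactS; congr (_ *: _).
have -> : (2 * k).+3%:Z = 2 * k.+1%:Z + 1 by lia.
have -> : (2 * k).+2%:Z = 2 * k.+1%:Z by lia.
by rewrite -/c mulrA [_ * c]mulrC invfM.
Qed.

Lemma tdot_odd_elt kappa M k : (2 * k + 4 <= M)%N ->
  tdot_odd E F Kinv kappa k = odd_elt kappa M k.+1%:Z.
Proof.
elim: k => [|k IH] le_kM.
  (* At m = 0 the recursion reads t = [1] o_1 + [0] o_0, which is the base case. *)
  have := tU_even_elt kappa M 0; rewrite even_elt0; last by lia.
  have qint1 : qint 1 = 1 by rewrite qintE (mulfV qq_subV_neq0).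
  rewrite mulr0 !add0r qint0 scale0r addr0 qint1 scale1r mulr1 => <-; last by lia.
  rewrite /tdot_odd big_nat1 subrr mulr0 qint0 scale0r subr0 qfactS qfact0 mulr1.
  by rewrite qint1 invr1 scale1r.
rewrite tdot_oddS IH; last by lia.
have tO := tU_odd_elt kappa M k.+1; have tE := tU_even_elt kappa M k.+1.
move: (tU E F Kinv kappa) tO tE => t tO tE.
(* Two recursion steps give t^2 o = [2k+2] ([2k+3] o' + [2k+2] o), with o' the successor of o;
   subtracting [2k+2]^2 o isolates o'. *)
rewrite mulrBl [t ^+ 2]expr2 -[t * t * _]mulrA tO; last by lia.
rewrite -scalerAr tE; last by lia.
rewrite mulr_algl [qint _ *: (_ + _)]scalerDr !scalerA -expr2 addrK scalerA mulVf ?scale1r.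
  by congr odd_elt; lia.
have -> : 2 * k.+1%:Z + 1 = (2 * k).+3%:Z by lia.
have -> : 2 * k.+1%:Z = (2 * k).+2%:Z by lia.
by apply: mulf_neq0; apply: qint_nat_neq0.
Qed.

(** The product in [tdot_even] at k + 1 is the one in [tdot_odd] at k, so one more multiplication by
    t suffices. *)
Lemma tdot_even_elt kappa M m : (1 <= m)%N -> (2 * m + 4 <= M)%N ->
  tdot_even E F Kinv kappa m = even_elt kappa M m%:Z.
Proof.
case: m => // k _ le_kM.
have -> : tdot_even E F Kinv kappa k.+1
    = (qint (2 * k.+1%:Z))^-1 *: (tU E F Kinv kappa * tdot_odd E F Kinv kappa k).
  rewrite /tdot_odd -scalerAr scalerA -invfM.
  have -> : 2 * k.+1%:Z = (2 * k).+2%:Z by lia.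
  rewrite -qfactS /tdot_even; have -> : (2 * k.+1)%N = (2 * k).+2 by lia.
  congr (_ *: (_ * _)); apply: eq_bigr => i _.
  by congr (_ - (qint (2 * _))%:A); lia.
rewrite (tdot_odd_elt kappa M); last by lia.
rewrite tU_odd_elt; last by lia.
rewrite scalerA mulVf ?scale1r //.
have -> : 2 * k.+1%:Z = (2 * k).+2%:Z by lia.
exact: qint_nat_neq0.
Qed.

(** * Back to the explicit triple sums *)

Lemma horner_alg_hpoly a n : ev (hpoly a n) = hbrace Kinv a n.
Proof.
rewrite /hpoly /hbrace rmorph_prod; apply: eq_bigr => i _ /=.
rewrite horner_algZ /nu rmorphB /= horner_algZ rmorphXn /= horner_algX horner_algC.
by [].
Qed.

Lemma horner_alg_kpow x (j : int) :
  pcoef_div j x *: ev (kpow j) = pcoef_div j x *: Kz K Kinv (- j).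
Proof.
case: j => [[|n]|n]; last by rewrite /= !scale0r.
  by rewrite /= rmorph1.
by rewrite /= rmorphXn /= horner_algX.
Qed.

Lemma pbw_sum_gpoly kappa M w (al : int) (n m : nat) : (n <= M)%N -> (m < M)%N ->
  (n < 2 * m.+1)%N ->
  pbw_sum M (twist (gpoly kappa M w al n%:Z)) =
  \sum_(0 <= b < n.+1) \sum_(0 <= a < b.+1) \sum_(0 <= c < m.+1)
    (qq ^ (w c - b%:Z * (n%:Z - b%:Z - 2 * c%:Z) - a%:Z * (b%:Z - a%:Z))
     * pcoef_div (n%:Z - b%:Z - 2 * c%:Z) kappa) *:
    (Ed a * hbrace Kinv al c * Kz K Kinv (- (n%:Z - b%:Z - 2 * c%:Z)) * Fd (b - a)).
Proof.
move=> le_nM lt_mM lt_nm.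
pose f i d := pbw i (twist (gpoly kappa M w al n%:Z) i d) d.
have f0 i d : (n < i + d)%N -> f i d = 0.
  by move=> lt_n; rewrite /f /twist gpoly_eq0 ?scaler0 ?pbw0 //; lia.
(* The square a, d <= M may be replaced by the triangle a + d <= M: terms with a + d > n vanish and
   n <= M. *)
transitivity (\sum_(0 <= b < M.+1) \sum_(0 <= a < b.+1) f a (b - a)%N).
  rewrite sum_triangle; apply: eq_bigr => i _; apply: sum_widen; first exact: leq_subr.
  by move=> d le_d; apply: f0; lia.
rewrite (sum_widen _ _ n.+1) // => [|b le_b]; last first.
  rewrite big_nat_cond big1 // => a; rewrite andbT => /andP[_ lt_a].
  by apply: f0; lia.
apply: eq_bigr => b _; rewrite [LHS]big_nat_cond [RHS]big_nat_cond.
apply: eq_bigr => a; rewrite andbT => /andP[_ lt_ab].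
rewrite /f /twist (_ : a%:Z + (b - a)%N%:Z = b%:Z); last by lia.
rewrite (_ : (b - a)%N%:Z = b%:Z - a%:Z); last by lia.
(* As n < 2(m+1), every term with c > m has p of negative index; the sum over all c >= 0 stops at c
   = m. *)
rewrite pbwZ (@gpoly_widen _ m.+1) //; last by lia.
rewrite /pbw /gpoly rmorph_sum mulr_sumr mulr_suml scaler_sumr; apply: eq_bigr => c _ /=.
have scale_out (s : Qq) (u h y v : A) : u * (s *: (h * y)) * v = u * h * (s *: y) * v.
  by rewrite -!scalerAr -!scalerAl mulrA.
rewrite horner_algZ rmorphM /= horner_alg_hpoly scale_out.
rewrite -[(_ * _) *: ev _]scalerA horner_alg_kpow.
rewrite scalerA -scale_out -(scalerAr (_ * _)) -(scalerAl (_ * _)) scalerA mulrA !mulrA.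
congr (_ * _ *: _); rewrite -qqD; congr (qq ^ _); ring.
Qed.

End Algebra.

Theorem theorem5p2 (A : algType Qq) (E F K Kinv : A) (l : int) (m : nat) :
  Uq_relations E F K Kinv ->
  (1 <= m)%N ->
  let kappa := qint (2 * l - 1) in
  tdot_even E F Kinv kappa m =
    \sum_(0 <= b < (2 * m).+1) \sum_(0 <= a < b.+1) \sum_(0 <= c < m.+1)
      (qq ^ ('C((2 * c)%N, 2)%:Z - 2 * c%:Z - b%:Z * (2 * m%:Z - b%:Z - 2 * c%:Z)
              - a%:Z * (b%:Z - a%:Z))
       * pcoef_div (2 * m%:Z - b%:Z - 2 * c%:Z) kappa) *:
      (Echkdiv E Kinv a * hbrace Kinv (2 - m%:Z) c
        * Kz K Kinv (b%:Z - 2 * m%:Z + 2 * c%:Z) * Fdiv F (b - a))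
  /\
  tdot_odd E F Kinv kappa m.-1 =
    \sum_(0 <= b < 2 * m) \sum_(0 <= a < b.+1) \sum_(0 <= c < m.+1)
      (qq ^ ('C((2 * c)%N, 2)%:Z - b%:Z * (2 * m%:Z - b%:Z - 2 * c%:Z - 1)
              - a%:Z * (b%:Z - a%:Z))
       * pcoef_div (2 * m%:Z - b%:Z - 2 * c%:Z - 1) kappa) *:
      (Echkdiv E Kinv a * hbrace Kinv (2 - m%:Z) c
        * Kz K Kinv (b%:Z - 2 * m%:Z + 2 * c%:Z + 1) * Fdiv F (b - a)).
Proof.
move=> rel m_ge1 kappa; split.
(* The auxiliary bound M = 2m + 4 is the least that [tdot_even_elt] admits; it disappears from the
   triple sum. *)
- rewrite (@tdot_even_elt _ _ _ _ _ rel kappa (2 * m + 4)) // /even_elt.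
  have -> : 2 * m%:Z = (2 * m)%N%:Z by lia.
  rewrite (pbw_sum_gpoly _ _ _ K _ _ _ _ _ _ m); [|lia..].
  apply: eq_bigr => b _; apply: eq_bigr => a _; apply: eq_bigr => c _.
  rewrite bin_double (_ : b%:Z - _ + _ = - ((2 * m)%N%:Z - b%:Z - 2 * c%:Z)); last by ring.
  by rewrite (_ : wexp 1 c = 2 * c%:Z * c%:Z - c%:Z - 2 * c%:Z); last by rewrite /wexp; ring.
- case: m m_ge1 => // k _; rewrite [k.+1.-1]/=.
  rewrite (@tdot_odd_elt _ _ _ _ _ rel kappa (2 * k + 4)) // /odd_elt.
  rewrite (_ : 2 * k.+1%:Z - 1 = (2 * k).+1%:Z); last by lia.
  rewrite (pbw_sum_gpoly _ _ _ K _ _ _ _ _ _ k.+1); [|lia..].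
  rewrite (_ : (2 * k.+1)%N = (2 * k).+2); last by lia.
  apply: eq_bigr => b _; apply: eq_bigr => a _; apply: eq_bigr => c _.
  have -> : 2 * k.+1%:Z - b%:Z - 2 * c%:Z - 1 = (2 * k).+1%:Z - b%:Z - 2 * c%:Z by lia.
  have -> : b%:Z - 2 * k.+1%:Z + 2 * c%:Z + 1 = - ((2 * k).+1%:Z - b%:Z - 2 * c%:Z) by lia.
  by rewrite bin_double (_ : wexp 0 c = 2 * c%:Z * c%:Z - c%:Z); last by rewrite /wexp; ring.
Qed.
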